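(* Let $S$ be a Damek--Ricci space in the half-space model $S\cong\mathfrak v\oplus\mathfrak z\times\mathbb R_+$. For any $x_0=(V_0,Z_0,t_0)\in\mathfrak v\oplus\mathfrak z\oplus\mathbb R$ (with $t_0$ an arbitrary real number), the function $D_{x_0}\colon S\to\mathbb R$, $$D_{x_0}((V,Z,t))=\frac1t\left(\left(t+t_0+\left\|\frac{V-V_0}{2}\right\|^2\right)^2+\left\|Z-Z_0+\tfrac12[V,V_0]\right\|^2\right),$$ is an isoparametric function on $S$.
   Context: Isoparametric function: a smooth function $F\colon M\to\mathbb R$ on a Riemannian manifold is isoparametric if there exist a continuous function $a\colon F(M)\to\mathbb R$ and a $\mathcal C^2$ function $b\colon F(M)\to\mathbb R$ with $\Delta F=a\circ F$ and $\|\nabla F\|^2=b\circ F$ ($\Delta$ is the Laplace--Beltrami operator, the trace of the Hessian). Damek--Ricci space: let $\mathfrak s=\mathfrak v\oplus\mathfrak z\oplus\mathfrak a$ be an orthogonal decomposition of a finite-dimensional Euclidean space $(\mathfrak s,\langle\,,\rangle)$ with $\mathfrak a=\mathbb RA$, $\|A\|=1$, $n=\dim\mathfrak v$, $m=\dim\mathfrak z$ (either may be $0$). Let $J$ be a representation on $\mathfrak v$ of the Clifford algebra $\mathrm{Cl}(\mathfrak z,q)$ of $q(Z)=-\langle Z,Z\rangle$ with $\|J_ZV\|=\|Z\|\|V\|$ for all $Z\in\mathfrak z,V\in\mathfrak v$. The Lie bracket on $\mathfrak s$ is determined by $\langle[U,V],Z\rangle=\langle J_ZU,V\rangle$ with $[U,V]\in\mathfrak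 z$ for $U,V\in\mathfrak v$, $Z\in\mathfrak z$; $[\mathfrak v\oplus\mathfrak z,\mathfrak z]=0$; $[A,V]=\frac12V$ for $V\in\mathfrak v$; $[A,Z]=Z$ for $Z\in\mathfrak z$. The simply connected Lie group $S$ with Lie algebra $\mathfrak s$ and the left-invariant metric induced by $\langle\,,\rangle$ is the Damek--Ricci space. Half-space model: $S$ is identified with $\mathfrak v\oplus\mathfrak z\times\mathbb R_+$ via $(V,Z,t)\mapsto\exp(V+Z)\exp((\ln t)A)$, where $\exp$ is the Lie group exponential map. The group multiplication is $(V_1,Z_1,t_1)(V_2,Z_2,t_2)=(V_1+\sqrt{t_1}V_2,\ Z_1+t_1Z_2+\frac12\sqrt{t_1}[V_1,V_2],\ t_1t_2)$. *)

(* Defs.v *)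
From HB Require Import structures.
From mathcomp Require Import all_boot all_order all_algebra.
From mathcomp Require Import all_classical all_reals all_analysis.

Set Implicit Arguments.
Unset Strict Implicit.
Unset Printing Implicit Defensive.

Import Order.TTheory GRing.Theory Num.Theory.
Import numFieldNormedType.Exports.

Local Open Scope classical_set_scope.
Local Open Scope ring_scope.

(* The canonical norm `|u| on 'rV[R]_k is the sup norm; the Euclidean structure
   of R^k is given by dot and enorm. *)
Definition dot (R : realType) (k : nat) (u v : 'rV[R]_k) : R :=
  \sum_(i < k) u ord0 i * v ord0 i.

Definition enorm (R : realType) (k : nat) (u : 'rV[R]_k) : R :=
  Num.sqrt (dot u u).

(** * Riemannian geometry in a global chart

    A Riemannian manifold covered by one chart is an open set [Om] of R^N with
    a field [g] of Gram matrices: g_x(u, v) = u *m g x *m v^T. *)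

Definition partial (R : realType) (N : nat) (i : 'I_N) (F : 'rV[R]_N -> R) :
    'rV[R]_N -> R :=
  fun x => 'D_(delta_mx ord0 i) F x.

Fixpoint Ck_on (R : realType) (N k : nat) (Om : set 'rV[R]_N)
    (F : 'rV[R]_N -> R) : Prop :=
  (forall x, Om x -> {for x, continuous F}) /\
  match k with
  | 0 => True
  | k'.+1 => forall i : 'I_N,
      (forall x, Om x -> derivable F x (delta_mx ord0 i)) /\
      Ck_on k' Om (partial i F)
  end.

Definition smooth_on (R : realType) (N : nat) (Om : set 'rV[R]_N)
    (F : 'rV[R]_N -> R) : Prop :=
  forall k : nat, Ck_on k Om F.

(* The coefficient Gamma^k_(i j) of the Levi-Civita connection of g. *)
Definition christoffel (R : realType) (N : nat) (g : 'rV[R]_N -> 'M[R]_N)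
    (k i j : 'I_N) (x : 'rV[R]_N) : R :=
  2^-1 * \sum_(l < N) invmx (g x) k l *
    (partial i (fun y => g y j l) x + partial j (fun y => g y i l) x
     - partial l (fun y => g y i j) x).

Definition hessian (R : realType) (N : nat) (g : 'rV[R]_N -> 'M[R]_N)
    (F : 'rV[R]_N -> R) (x : 'rV[R]_N) : 'M[R]_N :=
  \matrix_(i, j) (partial i (partial j F) x
                  - \sum_(k < N) christoffel g k i j x * partial k F x).

(* The trace of the Hessian with respect to g. *)
Definition laplace_beltrami (R : realType) (N : nat) (g : 'rV[R]_N -> 'M[R]_N)
    (F : 'rV[R]_N -> R) (x : 'rV[R]_N) : R :=
  \sum_(i < N) \sum_(j < N) invmx (g x) i j * hessian g F x i j.

Definition gradient (R : realType) (N : nat) (g : 'rV[R]_N -> 'M[R]_N)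
    (F : 'rV[R]_N -> R) (x : 'rV[R]_N) : 'rV[R]_N :=
  \row_i \sum_(j < N) invmx (g x) i j * partial j F x.

Definition riem_sqnorm (R : realType) (N : nat) (g : 'rV[R]_N -> 'M[R]_N)
    (x u : 'rV[R]_N) : R :=
  (u *m g x *m u^T) ord0 ord0.

(* F(M) need not be open (it can contain its infimum): a function on it is C^2
   when it is the restriction of a C^2 function on an open set. *)
Definition C2_on (R : realType) (X : set R) (b : R -> R) : Prop :=
  exists U : set R, [/\ open U, X `<=` U &
    forall y, U y -> [/\ derivable b y 1, derivable (derive1 b) y 1 &
                         {for y, continuous (derive1n 2 b)}]].

Definition isoparametric (R : realType) (N : nat) (Om : set 'rV[R]_N)
    (g : 'rV[R]_N -> 'M[R]_N) (F : 'rV[R]_N -> R) : Prop :=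
  smooth_on Om F /\
  exists a b : R -> R,
    [/\ {within F @` Om, continuous a},
        C2_on (F @` Om) b,
        forall x, Om x -> laplace_beltrami g F x = a (F x) &
        forall x, Om x -> riem_sqnorm g x (gradient g F x) = b (F x)].

(** * Clifford algebras and their representations *)

Definition is_clifford_algebra (R : realType) (V : lmodType R) (q : V -> R)
    (C : algType R) (iota : {linear V -> C}) : Prop :=
  (forall v, iota v * iota v = (q v)%:A) /\
  forall (B : algType R) (f : {linear V -> B}),
    (forall v, f v * f v = (q v)%:A) ->
    exists2 phi : {lrmorphism C -> B},
      forall v, phi (iota v) = f v &
      forall psi : {lrmorphism C -> B},
        (forall v, psi (iota v) = f v) -> psi =1 phi.

Record representation (R : realType) (C : algType R) (V : lmodType R) :=
  Representation {
  rep :> C -> {linear V -> V};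
  rep_add : forall x y v, rep (x + y) v = rep x v + rep y v;
  rep_scale : forall (c : R) x v, rep (c *: x) v = c *: rep x v;
  rep_one : forall v, rep 1 v = v;
  rep_mul : forall x y v, rep (x * y) v = rep x (rep y v) }.

(** * Damek-Ricci spaces *)

(* Orthonormal bases identify v with R^n and z with R^m. *)
Record damek_ricci (R : realType) (n m : nat) := DamekRicci {
  cliff : algType R;
  cliff_in : {linear 'rV[R]_m -> cliff};
  cliffP : is_clifford_algebra (fun Z => - dot Z Z) cliff_in;
  cliff_rep : representation cliff 'rV[R]_n;
  cliff_norm : forall (Z : 'rV[R]_m) (V : 'rV[R]_n),
    enorm (cliff_rep (cliff_in Z) V) = enorm Z * enorm V;
  (* the component v * v -> z of the Lie bracket *)
  br : 'rV[R]_n -> 'rV[R]_n -> 'rV[R]_m;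
  brP : forall (U V : 'rV[R]_n) (Z : 'rV[R]_m),
    dot (br U V) Z = dot (cliff_rep (cliff_in Z) U) V }.

Section HalfSpaceModel.
Variables (R : realType) (n m : nat).

(* (V, Z, t) as a point of R^(n + m + 1) *)
Definition pt (V : 'rV[R]_n) (Z : 'rV[R]_m) (t : R) : 'rV[R]_(n + m + 1) :=
  row_mx (row_mx V Z) t%:M.

Definition ptV (x : 'rV[R]_(n + m + 1)) : 'rV[R]_n := lsubmx (lsubmx x).
Definition ptZ (x : 'rV[R]_(n + m + 1)) : 'rV[R]_m := rsubmx (lsubmx x).
Definition ptt (x : 'rV[R]_(n + m + 1)) : R := rsubmx x ord0 ord0.

Definition half_space : set 'rV[R]_(n + m + 1) := [set x | 0 < ptt x].

Variable S : damek_ricci R n m.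

Definition dr_mul (x y : 'rV[R]_(n + m + 1)) : 'rV[R]_(n + m + 1) :=
  pt (ptV x + Num.sqrt (ptt x) *: ptV y)
     (ptZ x + ptt x *: ptZ y
      + (2^-1 * Num.sqrt (ptt x)) *: br S (ptV x) (ptV y))
     (ptt x * ptt y).

Definition dr_one : 'rV[R]_(n + m + 1) := pt 0 0 1.

(* The differential at the identity of the left translation by x, acting on
   row vectors. As exp((ln t) A) has velocity A at t = 1, the coordinates
   (V, Z, r) of a tangent vector at the identity are those of V + Z + r A. *)
Definition dr_dL (x : 'rV[R]_(n + m + 1)) : 'M[R]_(n + m + 1) :=
  jacobian (dr_mul x) dr_one.

(* g_x(u, v) = <dL_x^-1 u, dL_x^-1 v> *)
Definition dr_metric (x : 'rV[R]_(n + m + 1)) : 'M[R]_(n + m + 1) :=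
  invmx (dr_dL x) *m (invmx (dr_dL x))^T.

Definition dr_D (V0 : 'rV[R]_n) (Z0 : 'rV[R]_m) (t0 : R)
    (x : 'rV[R]_(n + m + 1)) : R :=
  (ptt x)^-1 *
    ((ptt x + t0 + enorm (2^-1 *: (ptV x - V0)) ^+ 2) ^+ 2
     + enorm (ptZ x - Z0 + 2^-1 *: br S (ptV x) V0) ^+ 2).

End HalfSpaceModel.

(* Main.v *)
Require Import Defs.
From HB Require Import structures.
From mathcomp Require Import all_boot all_order all_algebra.
From mathcomp Require Import all_classical all_reals all_analysis.
From mathcomp Require Import ring lra.

Set Implicit Arguments.
Unset Strict Implicit.
Unset Printing Implicit Defensive.

Import Order.TTheory GRing.Theory Num.Theory.
Import numFieldNormedType.Exports.

Local Open Scope classical_set_scope.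
Local Open Scope ring_scope.

(** Write [t] for the last coordinate of a point [x = (V, Z, t)], and
      [W = V - V0],  [h = t + t0 + |W|^2 / 4],  [zeta = Z - Z0 + [V, V0] / 2],
    so that the function is [D = (h^2 + |zeta|^2) / t].  It satisfies
      [|grad D|^2 = D^2 - 4 t0 D],
      [Delta D = (1 + n / 2 + m) D - 2 (1 + m) t0],
    and the right-hand sides are polynomials in [D] alone.

    Everything is computed in the left-invariant orthonormal frame
      [X_i = sqrt t (e_i + [V, e_i] / 2)],  [Y_j = t e_j],  [A = t d/dt].
    Along [X_i] the two brackets, one from the frame and one from [zeta],
    merge into a bracket with [W], which gives
      [X_i D = (h W + J_zeta W)_i / sqrt t],  [Y_j D = 2 zeta_j],
      [A D = 2 h - D].
    Each [J_zeta] is skew and multiplies lengths by [|zeta|]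
    (lemmas [Jop_skew], [dot_scale_add_Jop]), so the squares of the first
    family add up to [|W|^2 D], and the gradient formula follows from
    [|W|^2 / 4 = h - t - t0] (lemma [sum_D1_sqr]).

    In the trace of second derivatives (lemma [sum_D2]) the quadratic terms
    in [W] enter through [sum_i |[W, e_i]|^2 = m |W|^2] (lemma [sum_dot_br]).
    The first-order part of the Laplacian comes from the Koszul formula
    (lemma [laplace_beltrami_frame]), where only [A] contributes, with
    coefficient [n / 2 + m - 1] (lemma [sum_connection]).  In the total, [h],
    [t] and [|W|^2] combine to [2 (1 + m) (|W|^2 / 4 + t - h)], that is
    [- 2 (1 + m) t0]. *)

(** * The Euclidean dot product *)

Section DotProduct.
Variables (R : realType) (k : nat).
Implicit Types (u v w : 'rV[R]_k) (c : R).

Lemma dot_mulmx u v : dot u v = (u *m v^T) ord0 ord0.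
Proof. by rewrite mxE; apply: eq_bigr => i _; rewrite mxE. Qed.

Lemma dotC u v : dot u v = dot v u.
Proof. by apply: eq_bigr => i _; rewrite mulrC. Qed.

Lemma dotDl u v w : dot (u + v) w = dot u w + dot v w.
Proof. by rewrite !dot_mulmx mulmxDl mxE. Qed.

Lemma dotDr u v w : dot w (u + v) = dot w u + dot w v.
Proof. by rewrite !(dotC w) dotDl. Qed.

Lemma dotZl c u v : dot (c *: u) v = c * dot u v.
Proof. by rewrite !dot_mulmx -scalemxAl mxE. Qed.

Lemma dotZr c u v : dot v (c *: u) = c * dot v u.
Proof. by rewrite !(dotC v) dotZl. Qed.

Lemma dotNl u v : dot (- u) v = - dot u v.
Proof. by rewrite -scaleN1r dotZl mulN1r. Qed.

Lemma dot0l v : dot 0 v = 0.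
Proof. by rewrite -(scale0r v) dotZl mul0r. Qed.

Lemma dot0r v : dot v 0 = 0.
Proof. by rewrite dotC dot0l. Qed.

Lemma dot_delta u i : dot u (delta_mx ord0 i) = u ord0 i.
Proof.
rewrite /dot (bigD1 i) //= mxE !eqxx mulr1 big1 ?addr0 // => j ji.
by rewrite mxE (negPf ji) andbF mulr0.
Qed.

Lemma dot_delta_self i : dot (delta_mx ord0 i) (delta_mx ord0 i : 'rV[R]_k) = 1.
Proof. by rewrite dot_delta mxE !eqxx. Qed.

Lemma dot_inj u v : (forall w, dot u w = dot v w) -> u = v.
Proof. by move=> uv; apply/rowP => i; rewrite -!dot_delta uv. Qed.

Lemma dot_ge0 u : 0 <= dot u u.
Proof. by apply: sumr_ge0 => i _; rewrite -expr2 sqr_ge0. Qed.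

Lemma dot_eq0 u : (dot u u == 0) = (u == 0).
Proof.
apply/idP/eqP => [|->]; last by rewrite dot0l.
rewrite psumr_eq0 => [/allP u0|i _]; last by rewrite -expr2 sqr_ge0.
apply/rowP => i; rewrite mxE; apply/eqP; rewrite -sqrf_eq0 expr2.
exact: u0 (mem_index_enum _).
Qed.

Lemma enorm_sqr u : enorm u ^+ 2 = dot u u.
Proof. by rewrite /enorm sqr_sqrtr // dot_ge0. Qed.

End DotProduct.

(** * Clifford multiplication and the Lie bracket *)

Section CliffordMap.
Variables (R : realType) (n m : nat) (S : damek_ricci R n m).
Implicit Types (U V W : 'rV[R]_n) (Z : 'rV[R]_m).

(** The operator usually written J_Z. *)
Definition Jop Z V : 'rV[R]_n := cliff_rep S (cliff_in S Z) V.

Lemma Jop_linear_r Z : linear (Jop Z).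
Proof. by move=> a U V; rewrite /Jop linearP. Qed.

Lemma JopZl c Z V : Jop (c *: Z) V = c *: Jop Z V.
Proof. by rewrite /Jop linearZ rep_scale. Qed.

(** The Clifford relation [Z * Z = q(Z)] read in the representation. *)
Lemma JopK Z V : Jop Z (Jop Z V) = - dot Z Z *: V.
Proof.
by rewrite /Jop -rep_mul (cliffP S).1 rep_scale rep_one.
Qed.

Lemma dot_Jop_Jop Z V : dot (Jop Z V) (Jop Z V) = dot Z Z * dot V V.
Proof. by rewrite -!enorm_sqr -exprMn /Jop cliff_norm. Qed.

Lemma dot_Jop_polar Z U V :
  dot (Jop Z U) (Jop Z V) = dot Z Z * dot U V.
Proof.
have := dot_Jop_Jop Z (U + V).
have -> : Jop Z (U + V) = Jop Z U + Jop Z V by rewrite /Jop linearD.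
rewrite !dotDl !dotDr !dot_Jop_Jop (dotC V U) (dotC (Jop Z V)).
by move=> H; lra.
Qed.

(** Put [Jop Z V] for the second vector in the polarised norm identity: the
    Clifford relation turns it into [dot Z Z] times the claim, and [Z = 0] is
    trivial. *)
Lemma Jop_skew Z U V : dot (Jop Z U) V = - dot U (Jop Z V).
Proof.
have [->|Z0] := eqVneq Z 0.
  by rewrite -(scale0r 0) !JopZl !scale0r dot0l dot0r oppr0.
have := dot_Jop_polar Z U (Jop Z V).
have dZ0 : dot Z Z != 0 by rewrite dot_eq0.
by rewrite JopK dotZr mulNr -mulrN => /(mulfI dZ0) <-; rewrite opprK.
Qed.

Lemma dot_Jop_self Z V : dot (Jop Z V) V = 0.
Proof. by have := Jop_skew Z V V; rewrite (dotC V) => H; lra. Qed.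

(** [V] and [Jop Z V] are orthogonal.  This is the length of the horizontal
    part of the gradient computed at the end. *)
Lemma dot_scale_add_Jop c Z V :
  dot (c *: V + Jop Z V) (c *: V + Jop Z V) = (c ^+ 2 + dot Z Z) * dot V V.
Proof.
rewrite !(dotDl, dotDr, dotZl, dotZr) dot_Jop_Jop (dotC V) dot_Jop_self.
by ring.
Qed.

Lemma dot_br U V Z : dot (br S U V) Z = dot (Jop Z U) V.
Proof. exact: brP. Qed.

Lemma br_linear_l V : linear (fun U => br S U V).
Proof.
move=> a U W; apply: dot_inj => Z.
by rewrite dotDl dotZl !dot_br Jop_linear_r dotDl dotZl.
Qed.

Lemma br_linear_r U : linear (br S U).
Proof.
move=> a V W; apply: dot_inj => Z.
by rewrite dotDl dotZl !dot_br dotDr dotZr.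
Qed.

HB.instance Definition _ U :=
  GRing.isLinear.Build R 'rV[R]_n 'rV[R]_m *:%R (br S U) (br_linear_r U).

Lemma brDl U V W : br S (U + V) W = br S U W + br S V W.
Proof. by have := br_linear_l W 1 U V; rewrite !scale1r. Qed.

Lemma br_self U : br S U U = 0.
Proof. by apply: dot_inj => Z; rewrite dot_br dot_Jop_self dot0l. Qed.

Lemma brC U V : br S U V = - br S V U.
Proof.
apply/eqP; rewrite -addr_eq0 -(br_self (U + V)) brDl !linearD /= !br_self.
by rewrite add0r addr0.
Qed.

Lemma br0l V : br S 0 V = 0.
Proof. by rewrite brC linear0 oppr0. Qed.

Lemma brZl c U V : br S (c *: U) V = c *: br S U V.
Proof. by rewrite brC linearZ /= -scalerN -brC. Qed.

Lemma brZr c U V : br S U (c *: V) = c *: br S U V.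
Proof. by rewrite linearZ. Qed.

Lemma br0r U : br S U 0 = 0.
Proof. exact: linear0. Qed.

Lemma brBl U V W : br S (U - V) W = br S U W - br S V W.
Proof. by rewrite brDl -scaleN1r brZl scaleN1r. Qed.

(** The columns of the matrix with entries [dot (Jop e_j W) e_i] are the [m]
    vectors [Jop e_j W], each of length [enorm W]; its rows are the
    [br S W e_i].  Both sides are its squared Hilbert-Schmidt norm. *)
Lemma sum_dot_br W :
  \sum_(i < n) dot (br S W (delta_mx ord0 i)) (br S W (delta_mx ord0 i))
  = m%:R * dot W W.
Proof.
under eq_bigr do rewrite {1}/dot.
rewrite exchange_big /=.
transitivity (\sum_(j < m) dot W W); last first.
  by rewrite sumr_const card_ord mulr_natl.
apply: eq_bigr => j _.
transitivity (dot (Jop (delta_mx ord0 j) W) (Jop (delta_mx ord0 j) W)).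
  by apply: eq_bigr => i _; rewrite -!(dot_delta _ j) !dot_br !dot_delta.
by rewrite dot_Jop_Jop dot_delta_self mul1r.
Qed.

End CliffordMap.

(** * Directional derivatives *)

Section DirectionalDerivatives.
Variables (R : realType) (V W : normedModType R).
Implicit Types (x u : V).

(** The difference quotient is constant. *)
Lemma is_derive_linear (f : V -> W) x u : linear f -> is_derive x u f (f u).
Proof.
move=> lf.
have flf h : f (h *: u + x) - f x = h *: f u by rewrite lf addrK.
have fu : (fun h : R => h^-1 *: (f (h *: u + x) - f x)) @ 0^' --> f u.
  apply: (@cvg_trans _ ((fun=> f u) @ (0 : R)^')); last exact: cvg_cst.
  apply: near_eq_cvg; near=> h.
  by rewrite flf scalerA mulVf ?scale1r //; near: h; exact: nbhs_dnbhs_neq.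
split; first by apply/cvg_ex; exists (f u).
exact: (cvg_lim (@norm_hausdorff _ _) fu).
Unshelve. all: by end_near. Qed.

Lemma is_derive_affine (f : V -> W) (c : W) x u :
  linear f -> is_derive x u (fun y => f y + c) (f u).
Proof.
move=> lf; apply: is_derive_eq; last exact: addr0.
exact: (is_deriveD (is_derive_linear _ _ lf) (is_derive_cst c x u)).
Qed.

Lemma is_derive_const (c : W) x u : is_derive x u (fun=> c) 0.
Proof. exact: is_derive_cst. Qed.

Lemma is_derive_add (f g : V -> W) x u df dg :
  is_derive x u f df -> is_derive x u g dg ->
  is_derive x u (fun y => f y + g y) (df + dg).
Proof. exact: is_deriveD. Qed.

Lemma is_derive_mul (f g : V -> R) x u (df dg : R) :
  is_derive x u f df -> is_derive x u g dg ->
  is_derive x u (fun y => f y * g y) (df * g x + f x * dg).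
Proof.
move=> fx gx; apply: (is_derive_eq (is_deriveM fx gx)).
by rewrite addrC [g x *: _]mulrC.
Qed.

Lemma is_derive_inv (f : V -> R) x u (df : R) :
  f x != 0 -> is_derive x u f df ->
  is_derive x u (fun y => (f y)^-1) (- df / f x ^+ 2).
Proof.
move=> f0 [fx <-]; split; first exact: derivableV.
by rewrite deriveV // mulNr [_ / _]mulrC -mulNr.
Qed.

Lemma is_derive_dot k (a b : V -> 'rV[R]_k) x u da db :
  is_derive x u a da -> is_derive x u b db ->
  is_derive x u (fun y => dot (a y) (b y)) (dot da (b x) + dot (a x) db).
Proof.
have coordP (c : V -> 'rV[R]_k) dc i : is_derive x u c dc ->
    is_derive x u (fun y => c y ord0 i) (dc ord0 i).
  move=> [cx <-]; have /derivable_mxP/(_ ord0 i) cxi := cx.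
  by split=> //; rewrite derive_mx // mxE.
move=> ax bx; rewrite /dot -big_split /=.
rewrite [F in is_derive _ _ F _](_ : _ =
    \sum_(i < k) (fun y => a y ord0 i * b y ord0 i)); last first.
  by apply/funext => y; rewrite fct_sumE.
by apply: is_derive_sum => i; apply: is_derive_mul; exact: coordP.
Qed.

End DirectionalDerivatives.

(** * Functions of class C^k on an open set *)

Lemma scalar_row (R : realType) (N : nat) (F : 'rV[R]_N -> R) u :
  scalar F -> F u = \sum_i u ord0 i * F (delta_mx ord0 i).
Proof.
move=> lF; pose mF := GRing.isLinear.Build _ _ _ _ F lF.
pose L : {scalar 'rV[R]_N} := HB.pack F mF.
rewrite -[F u]/(L u) [in LHS](row_sum_delta u) linear_sum.
by apply: eq_bigr => i _; rewrite linearZ_LR.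
Qed.

Section SmoothFunctions.
Variables (R : realType) (N : nat) (Om : set 'rV[R]_N).
Hypothesis openOm : open Om.
Implicit Types F G : 'rV[R]_N -> R.

Lemma near_eq_open x F G :
  Om x -> (forall y, Om y -> F y = G y) -> {near x, F =1 G}.
Proof.
move=> Omx FG.
by apply: filterS (open_nbhs_nbhs (conj openOm Omx)) => y /FG.
Qed.

Lemma is_derive_partial F i x df :
  is_derive x (delta_mx ord0 i) F df -> partial i F x = df.
Proof. by case. Qed.

(** [partial i F] is only controlled on [Om], so the inductions on [k] below
    compare it there with an explicit function through this lemma; openness of
    [Om] is what makes partial derivatives local. *)
Lemma Ck_on_ext k F G :
  (forall x, Om x -> F x = G x) -> Ck_on k Om F -> Ck_on k Om G.
Proof.
have cG (H K : 'rV[R]_N -> R) : (forall x, Om x -> H x = K x) ->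
    (forall x, Om x -> {for x, continuous H}) ->
    forall x, Om x -> {for x, continuous K}.
  move=> HK cH x Omx; rewrite /prop_for /continuous_at -HK //.
  apply: cvg_trans (cH x Omx).
  exact: near_eq_cvg (near_eq_open Omx HK).
elim: k F G => [|k IHk] F G FG [cF dF]; first by split=> //; exact: cG cF.
split=> [|i]; first exact: cG cF.
have [dFi pFi] := dF i; split=> [x Omx|].
  exact: near_eq_derivable (near_eq_open Omx FG) (dFi x Omx).
apply: IHk pFi => x Omx.
exact: near_eq_derive (near_eq_open Omx FG).
Qed.

Lemma Ck_on_cst k (c : R) : Ck_on k Om (fun=> c).
Proof.
elim: k c => [|k IHk] c; first by split=> // x _; exact: cst_continuous.
split=> [x _|i]; first exact: cst_continuous.
split=> [x _|]; first exact: derivable_cst.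
by apply: Ck_on_ext (IHk 0) => x _; rewrite /partial derive_cst.
Qed.

Lemma Ck_on_coord k (i : 'I_N) : Ck_on k Om (fun x => x ord0 i).
Proof.
have dX j x : is_derive x (delta_mx ord0 j) (fun y : 'rV[R]_N => y ord0 i)
    ((delta_mx ord0 j : 'rV[R]_N) ord0 i).
  apply: (@is_derive_linear _ _ _ (fun y : 'rV[R]_N => y ord0 i : R)).
  by move=> a u v; rewrite !mxE.
case: k => [|k]; first by split=> // x _; exact: coord_continuous.
split=> [x _|j]; first exact: coord_continuous.
split=> [x _|]; first by have [] := dX j x.
apply: Ck_on_ext (Ck_on_cst k ((delta_mx ord0 j : 'rV[R]_N) ord0 i)) => x _.
by rewrite /partial; have [_ ->] := dX j x.
Qed.

Lemma Ck_onS k F : Ck_on k.+1 Om F -> Ck_on k Om F.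
Proof.
elim: k F => [|k IHk] F [cF dF]; split=> // i.
by have [dFi pFi] := dF i; split=> //; exact: IHk.
Qed.

Lemma Ck_onD k F G :
  Ck_on k Om F -> Ck_on k Om G -> Ck_on k Om (fun x => F x + G x).
Proof.
elim: k F G => [|k IHk] F G [cF dF] [cG dG].
  by split=> // x Omx; apply: continuousD; [exact: cF|exact: cG].
split=> [x Omx|i]; first by apply: continuousD; [exact: cF|exact: cG].
have [dFi pFi] := dF i; have [dGi pGi] := dG i.
split=> [x Omx|]; first by apply: derivableD; [exact: dFi|exact: dGi].
apply: Ck_on_ext (IHk _ _ pFi pGi) => x Omx.
by rewrite /partial -deriveD //; [exact: dFi|exact: dGi].
Qed.

Lemma Ck_onM k F G :
  Ck_on k Om F -> Ck_on k Om G -> Ck_on k Om (fun x => F x * G x).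
Proof.
elim: k F G => [|k IHk] F G kF kG; have [cF dF] := kF; have [cG dG] := kG.
  by split=> // x Omx; apply: continuousM; [exact: cF|exact: cG].
split=> [x Omx|i]; first by apply: continuousM; [exact: cF|exact: cG].
have [dFi pFi] := dF i; have [dGi pGi] := dG i.
split=> [x Omx|]; first by apply: derivableM; [exact: dFi|exact: dGi].
apply: Ck_on_ext (Ck_onD (IHk _ _ pFi (Ck_onS kG)) (IHk _ _ (Ck_onS kF) pGi)).
move=> x Omx; apply/esym/is_derive_partial/is_derive_mul; apply: derivableP.
  exact: dFi.
exact: dGi.
Qed.

(** The partial derivative of [1 / F] is [- partial i F * (1 / F)^2], in which
    [1 / F] already has the regularity given by the induction. *)
Lemma Ck_onV k F : (forall x, Om x -> F x != 0) ->
  Ck_on k Om F -> Ck_on k Om (fun x => (F x)^-1).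
Proof.
move=> F0; have cV (G : 'rV[R]_N -> R) : (forall x, Om x -> G x != 0) ->
    (forall x, Om x -> {for x, continuous G}) ->
    forall x, Om x -> {for x, continuous (fun y => (G y)^-1)}.
  by move=> G0 cG x Omx; apply: continuousV; [exact: G0|exact: cG].
elim: k => [|k IHk] kF; have [cF dF] := kF; first by split=> //; exact: cV.
split=> [|i]; first exact: cV.
have [dFi pFi] := dF i.
split=> [x Omx|]; first by apply: derivableV; [exact: F0|exact: dFi].
have kV := IHk (Ck_onS kF).
apply: Ck_on_ext (Ck_onM (Ck_onM (Ck_on_cst k (-1)) pFi) (Ck_onM kV kV)).
move=> x Omx; apply/esym/is_derive_partial; rewrite mulN1r -invfM -expr2.
by apply: is_derive_inv; [exact: F0|apply: derivableP; exact: dFi].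
Qed.

Lemma Ck_on_sum k (I : Type) (r : seq I) (F : I -> 'rV[R]_N -> R) :
  (forall i, Ck_on k Om (F i)) -> Ck_on k Om (fun x => \sum_(i <- r) F i x).
Proof.
move=> kF; elim: r => [|i r IHr].
  by apply: Ck_on_ext (Ck_on_cst k 0) => x _; rewrite big_nil.
by apply: Ck_on_ext (Ck_onD (kF i) IHr) => x _; rewrite big_cons.
Qed.

Lemma Ck_on_scalar k F : scalar F -> Ck_on k Om F.
Proof.
move=> lF; apply: Ck_on_ext (Ck_on_sum (index_enum 'I_N)
  (fun i => Ck_onM (Ck_on_coord k i) (Ck_on_cst k (F (delta_mx ord0 i))))).
by move=> x _; rewrite (scalar_row x lF).
Qed.

Lemma Ck_on_dot k p (a b : 'rV[R]_N -> 'rV[R]_p) :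
  (forall i, Ck_on k Om (fun x => a x ord0 i)) ->
  (forall i, Ck_on k Om (fun x => b x ord0 i)) ->
  Ck_on k Om (fun x => dot (a x) (b x)).
Proof. by move=> ka kb; apply: Ck_on_sum => i; exact: Ck_onM. Qed.

End SmoothFunctions.

(** * Gradient and Laplacian in an orthonormal frame *)

Section MovingFrame.
Variables (R : realType) (N : nat).

Definition biscalar (B : 'rV[R]_N -> 'rV[R]_N -> R) : Prop :=
  (forall w, scalar (B^~ w)) /\ (forall u, scalar (B u)).

Lemma sum_frame (A : 'M[R]_N) B : biscalar B ->
  \sum_i \sum_j (A^T *m A) i j * B (delta_mx ord0 i) (delta_mx ord0 j)
  = \sum_a B (row a A) (row a A).
Proof.
move=> [Bl Br].
transitivity (\sum_a \sum_i \sum_j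
    A a i * A a j * B (delta_mx ord0 i) (delta_mx ord0 j)); last first.
  apply: eq_bigr => a _; rewrite (scalar_row _ (Bl _)).
  apply: eq_bigr => i _; rewrite (scalar_row _ (Br _)) mulr_sumr.
  by apply: eq_bigr => j _; rewrite !mxE mulrA.
rewrite [RHS]exchange_big; apply: eq_bigr => i _.
rewrite [RHS]exchange_big; apply: eq_bigr => j _.
by rewrite mxE mulr_suml; apply: eq_bigr => a _; rewrite mxE.
Qed.

(* The rows of A form an orthonormal basis for g x. *)
Variables (g : 'rV[R]_N -> 'M[R]_N) (F : 'rV[R]_N -> R) (x : 'rV[R]_N).
Variable (A : 'M[R]_N).
Hypotheses (unitA : A \in unitmx) (gA : g x = invmx A *m (invmx A)^T).

Lemma invmx_frame : invmx (g x) = A^T *m A.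
Proof.
have gH : g x *m (A^T *m A) = 1%:M.
  rewrite gA mulmxA -(mulmxA (invmx A)) -trmx_mul mulmxV //.
  by rewrite trmx1 mulmx1 mulVmx.
have [gU _] := mulmx1_unit gH.
by rewrite -[LHS]mulmx1 -gH mulKmx.
Qed.

Variable F1 : 'rV[R]_N -> R.
Hypotheses (F1_lin : scalar F1)
  (F1E : forall i, partial i F x = F1 (delta_mx ord0 i)).

(** In an orthonormal basis the components of the gradient are the derivatives
    of [F] along the basis vectors. *)
Lemma riem_sqnorm_frame :
  riem_sqnorm g x (gradient g F x) = \sum_a F1 (row a A) ^+ 2.
Proof.
pose p : 'rV[R]_N := \row_j F1 (delta_mx ord0 j).
have gradE : gradient g F x = p *m (A^T *m A).
  rewrite -[A^T *m A]trmxK [(_ *m _)^T]trmx_mul trmxK; apply/rowP => i.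
  rewrite !mxE; apply: eq_bigr => j _.
  by rewrite invmx_frame F1E !mxE mulrC.
have pA a : (p *m A^T) ord0 a = F1 (row a A).
  rewrite mxE (scalar_row _ F1_lin); apply: eq_bigr => j _.
  by rewrite !mxE mulrC.
rewrite /riem_sqnorm gradE gA.
have -> : p *m (A^T *m A) *m (invmx A *m (invmx A)^T)
    *m (p *m (A^T *m A))^T = (p *m A^T) *m (p *m A^T)^T.
  rewrite !mulmxA mulmxK // !trmx_mul !trmxK !mulmxA.
  by rewrite -(mulmxA _ _ A^T) -trmx_mul mulmxV // trmx1 mulmx1.
rewrite -dot_mulmx; apply: eq_bigr => a _.
by rewrite -expr2 pA.
Qed.

Variable F2 : 'rV[R]_N -> 'rV[R]_N -> R.
Hypotheses (F2_lin : biscalar F2)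
  (F2E : forall i j,
     partial i (partial j F) x = F2 (delta_mx ord0 i) (delta_mx ord0 j)).

(* T d u w is the derivative of g (u, w) in the direction d. *)
Variable T : 'rV[R]_N -> 'rV[R]_N -> 'rV[R]_N -> R.
Hypotheses (T_lin1 : forall u w, scalar (fun d => T d u w))
  (T_lin : forall d, biscalar (T d))
  (TE : forall i j l, partial i (fun y => g y j l) x
     = T (delta_mx ord0 i) (delta_mx ord0 j) (delta_mx ord0 l)).

(** The trace of a bilinear form against [invmx (g x)] is the sum of its values
    on the basis.  Using this for the Hessian, and twice for the Christoffel
    symbols, leaves the Koszul formula for the constant extension of the basis
    vectors: only the values of [T] on the basis are needed, and no inverse
    matrix has to be differentiated. *)
Lemma laplace_beltrami_frame :
  laplace_beltrami g F x = \sum_a F2 (row a A) (row a A)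
    - \sum_b F1 (row b A) *
        \sum_a (T (row a A) (row a A) (row b A)
                - 2^-1 * T (row b A) (row a A) (row a A)).
Proof.
(* Twice the Christoffel symbol of the first kind. *)
pose C l i j := T i j l + T j i l - T l i j.
have C_lin l : biscalar (C l).
  split=> w c u v; rewrite /C T_lin1 ?(T_lin _).1 ?(T_lin _).2 ?T_lin1; ring.
pose D k l := F1 k * \sum_a C l (row a A) (row a A).
have D_lin : biscalar D.
  split=> w c u v; rewrite /D ?F1_lin; first by ring.
  have -> : \sum_a C (c *: u + v) (row a A) (row a A) =
      c * \sum_a C u (row a A) (row a A) + \sum_a C v (row a A) (row a A).
    rewrite mulr_sumr -big_split; apply: eq_bigr => a _ /=.
    by rewrite /C !(T_lin _).2 T_lin1; ring.
  by ring.
have chrE k i j : christoffel g k i j x = 2^-1 * \sum_l (A^T *m A) k l *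
    C (delta_mx ord0 l) (delta_mx ord0 i) (delta_mx ord0 j).
  by congr (_ * _); apply: eq_bigr => l _; rewrite invmx_frame !TE.
rewrite /laplace_beltrami invmx_frame.
transitivity (\sum_i \sum_j (A^T *m A) i j *
      F2 (delta_mx ord0 i) (delta_mx ord0 j)
    - \sum_i \sum_j (A^T *m A) i j *
        \sum_k christoffel g k i j x * F1 (delta_mx ord0 k)).
  rewrite -sumrB; apply: eq_bigr => i _; rewrite -sumrB; apply: eq_bigr => j _.
  rewrite -mulrBr [hessian _ _ _ _ _]mxE F2E; congr (_ * (_ - _)).
  by apply: eq_bigr => k _; rewrite F1E.
congr (_ - _); first exact: sum_frame F2_lin.
transitivity (2^-1 * \sum_k \sum_l (A^T *m A) k l *
    D (delta_mx ord0 k) (delta_mx ord0 l)).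
  transitivity (2^-1 * \sum_k \sum_l \sum_i \sum_j
      (A^T *m A) k l * (A^T *m A) i j * F1 (delta_mx ord0 k) *
      C (delta_mx ord0 l) (delta_mx ord0 i) (delta_mx ord0 j)); last first.
    congr (_ * _); apply: eq_bigr => k _; apply: eq_bigr => l _.
    rewrite /D -(sum_frame _ (C_lin _)) !mulr_sumr.
    apply: eq_bigr => i _; rewrite !mulr_sumr; apply: eq_bigr => j _.
    by ring.
  transitivity (2^-1 * \sum_i \sum_j \sum_k \sum_l
      (A^T *m A) k l * (A^T *m A) i j * F1 (delta_mx ord0 k) *
      C (delta_mx ord0 l) (delta_mx ord0 i) (delta_mx ord0 j)).
    rewrite mulr_sumr; apply: eq_bigr => i _.
    rewrite mulr_sumr; apply: eq_bigr => j _.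
    rewrite !mulr_sumr; apply: eq_bigr => k _.
    rewrite chrE !(mulr_sumr, mulr_suml); apply: eq_bigr => l _.
    by ring.
  congr (_ * _); rewrite pair_bigA /= [in RHS]pair_bigA /=.
  transitivity (\sum_(p : 'I_N * 'I_N) \sum_(q : 'I_N * 'I_N)
    (A^T *m A) q.1 q.2 * (A^T *m A) p.1 p.2 * F1 (delta_mx ord0 q.1) *
      C (delta_mx ord0 q.2) (delta_mx ord0 p.1) (delta_mx ord0 p.2)).
    by apply: eq_bigr => p _; rewrite pair_bigA.
  by rewrite exchange_big; apply: eq_bigr => q _; rewrite pair_bigA.
rewrite (sum_frame _ D_lin) mulr_sumr; apply: eq_bigr => b _.
rewrite /D mulrCA mulr_sumr; congr (_ * _); apply: eq_bigr => a _.
by rewrite /C; field.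
Qed.

End MovingFrame.

(** * Coordinates of the half-space model *)

Lemma mulmx_jacobian_affine (R : realType) (N p : nat)
    (f : 'rV[R]_N -> 'rV[R]_p) (c : 'rV[R]_p) (x u : 'rV[R]_N) :
  linear f -> u *m jacobian (fun y => f y + c) x = f u.
Proof.
move=> lf; have [_ <-] := is_derive_affine c x u lf.
rewrite deriveEjacobian //; apply: differentiableD => //.
have -> : f =
    \sum_(i < N) (fun y : 'rV[R]_N => y ord0 i *: f (delta_mx ord0 i)).
  pose mf := GRing.isLinear.Build _ _ _ _ f lf.
  pose L : {linear 'rV[R]_N -> 'rV[R]_p} := HB.pack f mf.
  apply/funext => y; rewrite fct_sumE -[f y]/(L y) [in LHS](row_sum_delta y).
  by rewrite linear_sum; apply: eq_bigr => i _; rewrite linearZ.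
apply: differentiable_sum => i.
by apply: differentiableZl; exact: differentiable_coord.
Qed.

Section HalfSpaceCoordinates.
Variables (R : realType) (n m : nat).
Implicit Types (x y u w : 'rV[R]_(n + m + 1)).

Lemma ptV_pt (V : 'rV[R]_n) (Z : 'rV[R]_m) (t : R) : ptV (pt V Z t) = V.
Proof. by rewrite /ptV /pt !row_mxKl. Qed.

Lemma ptZ_pt (V : 'rV[R]_n) (Z : 'rV[R]_m) (t : R) : ptZ (pt V Z t) = Z.
Proof. by rewrite /ptZ /pt row_mxKl row_mxKr. Qed.

Lemma ptt_pt (V : 'rV[R]_n) (Z : 'rV[R]_m) (t : R) : ptt (pt V Z t) = t.
Proof. by rewrite /ptt /pt row_mxKr mxE eqxx. Qed.

Lemma ptK x : pt (ptV x) (ptZ x) (ptt x) = x.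
Proof.
rewrite /pt /ptV /ptZ /ptt hsubmxK -[RHS]hsubmxK; congr row_mx.
by apply/rowP => i; rewrite !ord1 !mxE.
Qed.

Lemma ptV_linear : linear (@ptV R n m).
Proof. by move=> c x y; apply/rowP => i; rewrite !mxE. Qed.

Lemma ptZ_linear : linear (@ptZ R n m).
Proof. by move=> c x y; apply/rowP => i; rewrite !mxE. Qed.

Lemma ptt_scalar : scalar (@ptt R n m).
Proof. by move=> c x y; rewrite /ptt !mxE. Qed.

Lemma pt_linear c (V V' : 'rV[R]_n) (Z Z' : 'rV[R]_m) (t t' : R) :
  pt (c *: V + V') (c *: Z + Z') (c * t + t') = c *: pt V Z t + pt V' Z' t'.
Proof.
rewrite -[RHS]ptK ptV_linear ptZ_linear ptt_scalar.
by rewrite !ptV_pt !ptZ_pt !ptt_pt.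
Qed.

Lemma dot_pt (V V' : 'rV[R]_n) (Z Z' : 'rV[R]_m) (t t' : R) :
  dot (pt V Z t) (pt V' Z' t') = dot V V' + dot Z Z' + t * t'.
Proof.
rewrite !dot_mulmx /pt !tr_row_mx !mul_row_col !mxE; congr (_ + _).
by rewrite big_ord1 !mxE eqxx.
Qed.

Lemma sum_delta_pt (f : 'rV[R]_(n + m + 1) -> R) :
  \sum_i f (delta_mx ord0 i) =
    \sum_(i < n) f (pt (delta_mx ord0 i) 0 0)
    + \sum_(j < m) f (pt 0 (delta_mx ord0 j) 0) + f (pt 0 0 1).
Proof.
rewrite !big_split_ord /= big_ord1.
have d0 : delta_mx ord0 (ord0 : 'I_1) = 1%:M :> 'M[R]_1.
  by apply/matrixP => i j; rewrite !ord1 !mxE.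
congr (_ + _ + _); last by rewrite delta_mx_rshift d0 /pt row_mx0.
  by apply: eq_bigr => i _; rewrite !delta_mx_lshift /pt raddf0.
by apply: eq_bigr => i _; rewrite delta_mx_lshift delta_mx_rshift /pt raddf0.
Qed.

Lemma open_half_space : open (@half_space R n m).
Proof.
have ct : continuous (@ptt R n m).
  have -> : @ptt R n m = fun x => x ord0 (rshift (n + m) (ord0 : 'I_1)).
    by apply/funext => x; rewrite /ptt mxE.
  exact: coord_continuous.
apply: (@open_comp _ _ (@ptt R n m) [set t | 0 < t]); last exact: open_gt.
by move=> x _; exact: ct.
Qed.

End HalfSpaceCoordinates.

(** * The left-invariant metric and its derivatives *)

Section DamekRicciMetric.
Variables (R : realType) (n m : nat) (S : damek_ricci R n m).
Implicit Types (x y u w d : 'rV[R]_(n + m + 1)).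

(** The left-invariant field with value [u] at the identity. *)
Definition frame x u : 'rV[R]_(n + m + 1) :=
  pt (Num.sqrt (ptt x) *: ptV u)
     (ptt x *: ptZ u + (2^-1 * Num.sqrt (ptt x)) *: br S (ptV x) (ptV u))
     (ptt x * ptt u).

(** Up to the factor [t], the component of [u] along the left-invariant fields
    of the center.  The metric is diagonal in [ptV u], [vert x u] and [ptt u],
    with coefficients depending on [t] alone. *)
Definition vert x u : 'rV[R]_m := ptZ u - 2^-1 *: br S (ptV x) (ptV u).

Definition coframe x u : 'rV[R]_(n + m + 1) :=
  pt ((Num.sqrt (ptt x))^-1 *: ptV u) ((ptt x)^-1 *: vert x u)
     ((ptt x)^-1 * ptt u).

Lemma frame_linear x : linear (frame x).
Proof.
move=> c u w; rewrite /frame -pt_linear; congr pt.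
- by rewrite ptV_linear; apply/rowP => i; rewrite !mxE; ring.
- rewrite ptZ_linear ptV_linear br_linear_r.
  by apply/rowP => i; rewrite !mxE; ring.
- by rewrite ptt_scalar; ring.
Qed.

Lemma mulmx_dr_dL x u : u *m dr_dL S x = frame x u.
Proof.
rewrite -(mulmx_jacobian_affine (pt (ptV x) (ptZ x) 0) (dr_one R n m) u
  (@frame_linear x)); congr (_ *m jacobian _ _).
apply/funext => y; rewrite -[frame x y]scale1r -pt_linear !scale1r /dr_mul.
congr pt; first exact: addrC.
  by rewrite [RHS]addrC addrA.
by rewrite mul1r addr0.
Qed.

Lemma row_dr_dL x i : row i (dr_dL S x) = frame x (delta_mx ord0 i).
Proof. by rewrite rowE mulmx_dr_dL. Qed.

Variable x : 'rV[R]_(n + m + 1).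
Hypothesis x_pos : half_space x.

Let t_gt0 : 0 < ptt x. Proof. exact: x_pos. Qed.
Let t_neq0 : ptt x != 0. Proof. by rewrite gt_eqF. Qed.
Let s_neq0 : Num.sqrt (ptt x) != 0. Proof. by rewrite gt_eqF ?sqrtr_gt0. Qed.
Let s_sqr : Num.sqrt (ptt x) ^+ 2 = ptt x.
Proof. by rewrite sqr_sqrtr ?ltW. Qed.

Lemma coframeK u : frame x (coframe x u) = u.
Proof.
rewrite -[RHS]ptK /frame /coframe !(ptV_pt, ptZ_pt, ptt_pt); congr pt.
- by rewrite scalerA divff // scale1r.
- rewrite scalerA divff // scale1r brZr scalerA -mulrA divff //.
  by rewrite mulr1 subrK.
- by rewrite mulrA divff // mul1r.
Qed.

Lemma unitmx_dr_dL : dr_dL S x \in unitmx.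
Proof.
pose B := \matrix_i coframe x (delta_mx ord0 i).
have : B *m dr_dL S x = 1%:M.
  by apply/row_matrixP => i; rewrite row_mul rowK mulmx_dr_dL coframeK row1.
by case/mulmx1_unit.
Qed.

Lemma mulmx_invmx_dr_dL u : u *m invmx (dr_dL S x) = coframe x u.
Proof.
by rewrite -[in LHS](coframeK u) -mulmx_dr_dL mulmxK // unitmx_dr_dL.
Qed.

Definition dr_gram y u w : R :=
  (ptt y)^-1 * dot (ptV u) (ptV w)
  + (ptt y)^-1 * (ptt y)^-1 * (dot (vert y u) (vert y w) + ptt u * ptt w).

(** The square root of [t] enters [coframe] once for each argument of the
    metric, hence squared: the metric is rational in the coordinates. *)
Lemma dr_metricE i j :
  dr_metric S x i j = dr_gram x (delta_mx ord0 i) (delta_mx ord0 j).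
Proof.
have -> : dr_metric S x i j =
    dot (coframe x (delta_mx ord0 i)) (coframe x (delta_mx ord0 j)).
  rewrite dot_mulmx -!mulmx_invmx_dr_dL trmx_mul mulmxA.
  rewrite -(mulmxA (delta_mx _ i)).
  rewrite -rowE -/(dr_metric S x) trmx_delta -colE !mxE.
  by [].
rewrite /coframe dot_pt !dotZl !dotZr /dr_gram mulrDr mulrA -invfM -expr2 s_sqr.
by ring.
Qed.

Definition dr_gram1 d u w : R :=
  - ptt d / ptt x ^+ 2 * dot (ptV u) (ptV w)
  - 2 * ptt d / ptt x ^+ 3 * (dot (vert x u) (vert x w) + ptt u * ptt w)
  - (dot (br S (ptV d) (ptV u)) (vert x w)
     + dot (vert x u) (br S (ptV d) (ptV w))) / (2 * ptt x ^+ 2).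

Lemma is_derive_vert d u :
  is_derive x d (vert^~ u) (- 2^-1 *: br S (ptV d) (ptV u)).
Proof.
have -> : vert^~ u = fun y => - 2^-1 *: br S (ptV y) (ptV u) + ptZ u.
  by apply/funext => y; rewrite addrC scaleNr.
apply: (@is_derive_affine _ _ _ (fun y => - 2^-1 *: br S (ptV y) (ptV u))).
move=> c y z; rewrite ptV_linear br_linear_l scalerDr !scalerA.
by rewrite (mulrC c).
Qed.

Lemma is_derive_ptt d : is_derive x d (@ptt R n m) (ptt d).
Proof. exact: is_derive_linear (@ptt_scalar R n m). Qed.

Lemma is_derive_dr_gram d u w :
  is_derive x d (fun y => dr_gram y u w) (dr_gram1 d u w).
Proof.
have dV := is_derive_inv t_neq0 (is_derive_ptt d).
have dc (c : R) := is_derive_const c x d.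
have d1 := is_derive_mul dV (dc (dot (ptV u) (ptV w))).
have d2 := is_derive_dot (is_derive_vert d u) (is_derive_vert d w).
have d3 := is_derive_mul (is_derive_mul dV dV)
  (is_derive_add d2 (dc (ptt u * ptt w))).
apply: (is_derive_eq (is_derive_add d1 d3)).
rewrite /dr_gram1 !(dotZl, dotZr); field.
exact: t_neq0.
Qed.

Lemma dr_gram1_lin1 u w : scalar (fun d => dr_gram1 d u w).
Proof.
move=> c d e; rewrite /dr_gram1 ptt_scalar ptV_linear !br_linear_l.
by rewrite !(dotDl, dotDr, dotZl, dotZr); ring.
Qed.

Lemma vert_linear : linear (vert x).
Proof.
move=> c u w; rewrite /vert ptV_linear ptZ_linear br_linear_r.
by apply/rowP => i; rewrite !mxE; ring.
Qed.

Lemma dr_gram1_lin d : biscalar (dr_gram1 d).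
Proof.
split=> v c u w; rewrite /dr_gram1 ptt_scalar vert_linear ptV_linear
  !br_linear_r.
  by rewrite !(dotDl, dotDr, dotZl, dotZr); ring.
by rewrite !(dotDl, dotDr, dotZl, dotZr); ring.
Qed.

End DamekRicciMetric.

Lemma partial_dr_metric (R : realType) (n m : nat) (S : damek_ricci R n m) x :
  half_space x -> forall i j l,
  partial i (fun y => dr_metric S y j l) x =
  dr_gram1 S x (delta_mx ord0 i) (delta_mx ord0 j) (delta_mx ord0 l).
Proof.
move=> x_pos i j l; apply: is_derive_partial.
apply: near_eq_is_derive (is_derive_dr_gram S x_pos _ _ _).
apply: (near_eq_open (@open_half_space R n m) x_pos) => y y_pos.
by rewrite dr_metricE.
Qed.

(** * The two differentials of the function *)

Section DistanceLikeFunction.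
Variables (R : realType) (n m : nat) (S : damek_ricci R n m).
Variables (V0 : 'rV[R]_n) (Z0 : 'rV[R]_m) (t0 : R).
Implicit Types (x y u w d : 'rV[R]_(n + m + 1)).

Let D := dr_D S V0 Z0 t0.

Definition shiftV x : 'rV[R]_n := ptV x - V0.

Definition height x : R := ptt x + t0 + 4^-1 * dot (shiftV x) (shiftV x).

Definition shiftZ x : 'rV[R]_m := ptZ x - Z0 + 2^-1 *: br S (ptV x) V0.

Definition shiftZ1 u : 'rV[R]_m := ptZ u + 2^-1 *: br S (ptV u) V0.

Definition numer x : R := height x ^+ 2 + dot (shiftZ x) (shiftZ x).

Lemma dr_DE x : D x = (ptt x)^-1 * numer x.
Proof.
rewrite /D /dr_D !enorm_sqr /numer /height -/(shiftV x) -/(shiftZ x).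
by rewrite dotZl dotZr mulrA -invfM -natrM.
Qed.

(** The suffixes 1 and 2 mark first and second differentials. *)
Definition height1 x u : R := ptt u + 2^-1 * dot (shiftV x) (ptV u).

Definition height2 u w : R := 2^-1 * dot (ptV u) (ptV w).

Definition numer1 x u : R :=
  2 * (height x * height1 x u + dot (shiftZ x) (shiftZ1 u)).

Definition numer2 x u w : R :=
  2 * (height1 x u * height1 x w + height x * height2 u w
       + dot (shiftZ1 u) (shiftZ1 w)).

Definition dr_D1 x u : R :=
  (ptt x)^-1 * numer1 x u - numer x * ((ptt x)^-1 * (ptt x)^-1) * ptt u.

Definition dr_D2 x u w : R :=
  numer2 x u w / ptt x
  - (ptt u * numer1 x w + numer1 x u * ptt w) / ptt x ^+ 2
  + 2 * numer x * ptt u * ptt w / ptt x ^+ 3.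

Lemma is_derive_shiftV x u : is_derive x u shiftV (ptV u).
Proof. exact: is_derive_affine (@ptV_linear R n m). Qed.

Lemma shiftZ1_linear : linear shiftZ1.
Proof.
move=> c u w; rewrite /shiftZ1 ptZ_linear ptV_linear br_linear_l.
by apply/rowP => i; rewrite !mxE; ring.
Qed.

Lemma is_derive_shiftZ x u : is_derive x u shiftZ (shiftZ1 u).
Proof.
have -> : shiftZ = fun y => shiftZ1 y + - Z0.
  by apply/funext => y; rewrite /shiftZ addrAC.
exact: is_derive_affine shiftZ1_linear.
Qed.

Lemma is_derive_height x u : is_derive x u height (height1 x u).
Proof.
have dV := is_derive_shiftV x u.
have d1 := is_derive_add (is_derive_ptt x u) (is_derive_const t0 x u).
have d2 := is_derive_mul (is_derive_const (4^-1 : R) x u) (is_derive_dot dV dV).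
apply: (is_derive_eq (is_derive_add d1 d2)).
by rewrite /height1 (dotC (ptV u)); field.
Qed.

Lemma is_derive_height1 x u w : is_derive x u (height1^~ w) (height2 u w).
Proof.
have dc (c : R) := is_derive_const c x u.
have d1 := is_derive_dot (is_derive_shiftV x u) (is_derive_cst (ptV w) x u).
apply: (is_derive_eq (is_derive_add (dc (ptt w)) (is_derive_mul (dc 2^-1) d1))).
by rewrite /height2 dot0r; ring.
Qed.

Lemma is_derive_numer x u : is_derive x u numer (numer1 x u).
Proof.
have dh := is_derive_height x u; have dZ := is_derive_shiftZ x u.
have := is_derive_add (is_derive_mul dh dh) (is_derive_dot dZ dZ).
move/is_derive_eq; apply.
by rewrite /numer1 (dotC (shiftZ1 u)); ring.
Qed.

Lemma is_derive_numer1 x u w : is_derive x u (numer1^~ w) (numer2 x u w).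
Proof.
have d1 := is_derive_mul (is_derive_height x u) (is_derive_height1 x u w).
have d2 := is_derive_dot (is_derive_shiftZ x u)
  (is_derive_cst (shiftZ1 w) x u).
have d3 := is_derive_mul (is_derive_const (2 : R) x u) (is_derive_add d1 d2).
by apply: (is_derive_eq d3); rewrite /numer2 dot0r; ring.
Qed.

Lemma is_derive_D x u : half_space x -> is_derive x u D (dr_D1 x u).
Proof.
move=> x_pos; have t_neq0 : ptt x != 0 by rewrite gt_eqF.
have dV := is_derive_inv t_neq0 (is_derive_ptt x u).
have -> : D = fun y => (ptt y)^-1 * numer y by apply/funext => y; exact: dr_DE.
apply: (is_derive_eq (is_derive_mul dV (is_derive_numer x u))).
by rewrite /dr_D1; field.
Qed.

Lemma is_derive_D1 x u w :
  half_space x -> is_derive x u (dr_D1^~ w) (dr_D2 x u w).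
Proof.
move=> x_pos; have t_neq0 : ptt x != 0 by rewrite gt_eqF.
have dV := is_derive_inv t_neq0 (is_derive_ptt x u).
have d1 := is_derive_mul dV (is_derive_numer1 x u w).
have d2 := is_derive_mul (is_derive_mul (is_derive_numer x u)
  (is_derive_mul dV dV)) (is_derive_const (- ptt w : R) x u).
have -> : dr_D1^~ w = fun y => (ptt y)^-1 * numer1 y w
    + numer y * ((ptt y)^-1 * (ptt y)^-1) * (- ptt w).
  by apply/funext => y; rewrite /dr_D1 mulrN.
apply: (is_derive_eq (is_derive_add d1 d2)).
by rewrite /dr_D2; field.
Qed.

Lemma partial_D x i : half_space x -> partial i D x = dr_D1 x (delta_mx ord0 i).
Proof. by move=> x_pos; apply: is_derive_partial; exact: is_derive_D. Qed.

Lemma partial_partial_D x i j : half_space x ->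
  partial i (partial j D) x = dr_D2 x (delta_mx ord0 i) (delta_mx ord0 j).
Proof.
move=> x_pos; apply: is_derive_partial.
apply: near_eq_is_derive (is_derive_D1 _ _ x_pos).
apply: (near_eq_open (@open_half_space R n m) x_pos) => y y_pos.
by rewrite partial_D.
Qed.

Lemma height1_scalar x : scalar (height1 x).
Proof.
by move=> c u w; rewrite /height1 ptt_scalar ptV_linear dotDr dotZr; ring.
Qed.

Lemma numer1_scalar x : scalar (numer1 x).
Proof.
move=> c u w.
by rewrite /numer1 height1_scalar shiftZ1_linear dotDr dotZr; ring.
Qed.

Lemma dr_D1_scalar x : scalar (dr_D1 x).
Proof. by move=> c u w; rewrite /dr_D1 numer1_scalar ptt_scalar; ring. Qed.

Lemma dr_D2_biscalar x : biscalar (dr_D2 x).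
Proof.
split=> v c u w; rewrite /dr_D2 /numer2 /height2 !ptt_scalar numer1_scalar
  height1_scalar shiftZ1_linear ptV_linear !(dotDl, dotDr, dotZl, dotZr); ring.
Qed.

(** [dr_D] is a polynomial in the coordinates divided by [t]. *)
Lemma smooth_D : smooth_on (@half_space R n m) D.
Proof.
move=> k; have oH := @open_half_space R n m.
have kt := Ck_on_scalar oH k (@ptt_scalar R n m).
have kc c := Ck_on_cst oH k c.
have kV i : Ck_on k (@half_space R n m) (fun x => shiftV x ord0 i).
  apply: (Ck_on_ext oH _ (Ck_onD oH (Ck_on_scalar oH k
    (_ : scalar (fun x => ptV x ord0 i))) (kc (- V0 ord0 i)))) => [x _|c x y].
    by rewrite !mxE.
  by rewrite ptV_linear !mxE.
have kZ i : Ck_on k (@half_space R n m) (fun x => shiftZ x ord0 i).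
  apply: (Ck_on_ext oH _ (Ck_onD oH (Ck_on_scalar oH k
    (_ : scalar (fun x => shiftZ1 x ord0 i))) (kc (- Z0 ord0 i))))
    => [x _|c x y].
    by rewrite !mxE addrAC.
  by rewrite shiftZ1_linear !mxE.
have kh : Ck_on k (@half_space R n m) height.
  apply: Ck_onD (Ck_onM oH (kc 4^-1) (Ck_on_dot oH kV kV)) => //.
  exact: Ck_onD kt (kc t0).
have kN : Ck_on k (@half_space R n m) numer.
  exact: Ck_onD (Ck_onM oH kh kh) (Ck_on_dot oH kZ kZ).
apply: (Ck_on_ext oH _ (Ck_onM oH (Ck_onV oH _ kt) kN)) => x x_pos.
  by rewrite dr_DE.
by rewrite gt_eqF.
Qed.

End DistanceLikeFunction.

(** * Evaluation on the left-invariant frame *)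

Section FrameEvaluation.
Variables (R : realType) (n m : nat) (S : damek_ricci R n m).
Variable x : 'rV[R]_(n + m + 1).
Hypothesis x_pos : half_space x.

Definition frameV i := frame S x (pt (delta_mx ord0 i) 0 0).
Definition frameZ j := frame S x (pt 0 (delta_mx ord0 j) 0).
Definition frameA := frame S x (pt 0 0 1).

Lemma sum_dr_frame (f : 'rV[R]_(n + m + 1) -> R) :
  \sum_a f (row a (dr_dL S x)) =
  \sum_(i < n) f (frameV i) + \sum_(j < m) f (frameZ j) + f frameA.
Proof.
under eq_bigr do rewrite row_dr_dL.
exact: (sum_delta_pt (fun u => f (frame S x u))).
Qed.

Let t := ptt x.
Let s := Num.sqrt t.
Let e {k} i : 'rV[R]_k := delta_mx ord0 i.

Let t_neq0 : t != 0. Proof. by rewrite gt_eqF //; exact: x_pos. Qed.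
Let s_sqr : s ^+ 2 = t. Proof. by rewrite sqr_sqrtr ?ltW //; exact: x_pos. Qed.

Lemma frameVE i : [/\ ptV (frameV i) = s *: e i,
  ptZ (frameV i) = (2^-1 * s) *: br S (ptV x) (e i),
  ptt (frameV i) = 0 & vert S x (frameV i) = 0].
Proof.
rewrite /vert /frameV /frame !(ptV_pt, ptZ_pt, ptt_pt); split=> //.
- by rewrite scaler0 add0r.
- exact: mulr0.
- by rewrite brZr scaler0 add0r scalerA subrr.
Qed.

Lemma frameZE j : [/\ ptV (frameZ j) = 0, ptZ (frameZ j) = t *: e j,
  ptt (frameZ j) = 0 & vert S x (frameZ j) = t *: e j].
Proof.
rewrite /vert /frameZ /frame !(ptV_pt, ptZ_pt, ptt_pt).
by rewrite !(scaler0, br0r, mulr0, addr0, subr0).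
Qed.

Lemma frameAE : [/\ ptV frameA = 0, ptZ frameA = 0, ptt frameA = t &
  vert S x frameA = 0].
Proof.
rewrite /vert /frameA /frame !(ptV_pt, ptZ_pt, ptt_pt).
by rewrite !(scaler0, br0r, mulr1, addr0, subr0).
Qed.

(** These are the values needed by the Koszul formula.  Every bracket term drops
    out: it is a bracket of a vector with itself, has a zero entry, or is paired
    with a frame vector whose [vert] vanishes.  What is left are logarithmic
    derivatives of powers of [t]. *)
Lemma dr_gram1_frameVV i w : dr_gram1 S x (frameV i) (frameV i) w = 0.
Proof.
have [pV _ pt v] := frameVE i; rewrite /dr_gram1 pV pt v br_self !dot0l.
by rewrite !(mulr0, oppr0, mul0r, addr0).
Qed.

Lemma dr_gram1_frameZZ j w : dr_gram1 S x (frameZ j) (frameZ j) w = 0.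
Proof.
have [pV _ pt v] := frameZE j; rewrite /dr_gram1 pV pt !br0l !dot0l !dot0r.
by rewrite !(mulr0, oppr0, mul0r, addr0).
Qed.

Lemma dr_gram1_frameAA w :
  dr_gram1 S x frameA frameA w = - 2 * (ptt w / t).
Proof.
have [pV _ pt v] := frameAE; rewrite /dr_gram1 pV pt v !br0l !dot0l -/t.
by field.
Qed.

Lemma dr_gram1_frameV i w :
  dr_gram1 S x w (frameV i) (frameV i) = - (ptt w / t).
Proof.
have [pV _ pt v] := frameVE i; rewrite /dr_gram1 pV pt v !dot0l !dot0r.
rewrite dotZl dotZr dot_delta_self mulr1 -[s * s]expr2 s_sqr -/t.
by field.
Qed.

Lemma dr_gram1_frameZ j w :
  dr_gram1 S x w (frameZ j) (frameZ j) = - 2 * (ptt w / t).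
Proof.
have [pV _ pt v] := frameZE j; rewrite /dr_gram1 pV pt v !br0r !dot0l !dot0r.
by rewrite dotZl dotZr dot_delta_self mulr1 -/t; field.
Qed.

Lemma dr_gram1_frameA w :
  dr_gram1 S x w frameA frameA = - 2 * (ptt w / t).
Proof.
have [pV _ pt v] := frameAE; rewrite /dr_gram1 pV pt v !br0r !dot0l -/t.
by field.
Qed.

(** The volume density is [t] to the power [- (n / 2 + m + 1)], and the terms
    with factor [2^-1] add up to its logarithmic derivative along [w].  The
    others vanish except at [frameA], which contributes
    [- 2 * (ptt w / t)]. *)
Lemma sum_connection w :
  \sum_a (dr_gram1 S x (row a (dr_dL S x)) (row a (dr_dL S x)) w
    - 2^-1 * dr_gram1 S x w (row a (dr_dL S x)) (row a (dr_dL S x)))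
  = (n%:R / 2 + m%:R - 1) * (ptt w / t).
Proof.
rewrite (sum_dr_frame (fun u =>
  dr_gram1 S x u u w - 2^-1 * dr_gram1 S x w u u)).
rewrite dr_gram1_frameAA dr_gram1_frameA.
under eq_bigr do rewrite dr_gram1_frameVV dr_gram1_frameV.
under [X in _ + X + _]eq_bigr do rewrite dr_gram1_frameZZ dr_gram1_frameZ.
rewrite !sumr_const !card_ord -(mulr_natl _ n) -(mulr_natl _ m).
by field.
Qed.

Variables (V0 : 'rV[R]_n) (Z0 : 'rV[R]_m) (t0 : R).
Let W := shiftV V0 x.
Let zeta := shiftZ S V0 Z0 x.
Let h := height V0 t0 x.
Let N := numer S V0 Z0 t0 x.

(** The bracket with [V] in the frame and the bracket with [V0] in the function
    combine into a bracket with [W = V - V0], as left-invariance requires. *)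
Lemma differentials_frameV i : height1 V0 x (frameV i) = 2^-1 * s * W ord0 i /\
  shiftZ1 S V0 (frameV i) = (2^-1 * s) *: br S W (e i).
Proof.
have [pV pZ pt _] := frameVE i; rewrite /height1 /shiftZ1 pV pZ pt; split.
  by rewrite dotZr dot_delta add0r mulrA.
by rewrite brZl (brC S (e i)) scalerA -scalerDr -brBl.
Qed.

(** Both terms of the derivative carry the same vector [W]: the bracket in
    [shiftZ1] was turned into [br S W e_i], which pairs with [zeta] as
    [Jop S zeta W]. *)
Lemma dr_D1_frameV i :
  dr_D1 S V0 Z0 t0 x (frameV i) = s / t * (h *: W + Jop S zeta W) ord0 i.
Proof.
have [_ _ pt _] := frameVE i; have [h1 z1] := differentials_frameV i.
rewrite /dr_D1 /numer1 pt h1 z1 dotZr (dotC _ (br _ _ _)) dot_br dot_delta !mxE.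
by rewrite -/zeta -/h -/t; field.
Qed.

Lemma dr_D2_frameV i : dr_D2 S V0 Z0 t0 x (frameV i) (frameV i) =
  2^-1 * (W ord0 i * W ord0 i) + h + 2^-1 * dot (br S W (e i)) (br S W (e i)).
Proof.
have [pV _ pt _] := frameVE i; have [h1 z1] := differentials_frameV i.
rewrite /dr_D2 /numer2 /height2 pt pV h1 z1 !(dotZl, dotZr) dot_delta_self.
(* Each of the three terms carries the factor s^2 = t. *)
have -> : forall a b c : R, 2 * (2^-1 * s * a * (2^-1 * s * a)
    + b * (2^-1 * (s * (s * 1))) + 2^-1 * s * (2^-1 * s * c)) =
    s ^+ 2 * (2^-1 * (a * a) + b + 2^-1 * c) by move=> *; field.
by rewrite s_sqr -/h -/t; field.
Qed.

Lemma differentials_frameZ j : height1 V0 x (frameZ j) = 0 /\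
  shiftZ1 S V0 (frameZ j) = t *: e j.
Proof.
have [pV pZ pt _] := frameZE j; rewrite /height1 /shiftZ1 pV pZ pt.
by rewrite dot0r br0l scaler0 mulr0 !addr0.
Qed.

Lemma dr_D1_frameZ j : dr_D1 S V0 Z0 t0 x (frameZ j) = 2 * zeta ord0 j.
Proof.
have [_ _ pt _] := frameZE j; have [h1 z1] := differentials_frameZ j.
by rewrite /dr_D1 /numer1 pt h1 z1 dotZr dot_delta -/zeta -/t; field.
Qed.

Lemma dr_D2_frameZ j : dr_D2 S V0 Z0 t0 x (frameZ j) (frameZ j) = 2 * t.
Proof.
have [pV _ pt _] := frameZE j; have [h1 z1] := differentials_frameZ j.
rewrite /dr_D2 /numer2 /height2 pt pV h1 z1 !(dotZl, dotZr) dot_delta_self.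
by rewrite dot0l mulr1 -/t; field.
Qed.

Lemma differentials_frameA : height1 V0 x frameA = t /\ shiftZ1 S V0 frameA = 0.
Proof.
have [pV pZ pt _] := frameAE; rewrite /height1 /shiftZ1 pV pZ pt.
by rewrite dot0r br0l scaler0 mulr0 !addr0.
Qed.

Lemma dr_D1_frameA : dr_D1 S V0 Z0 t0 x frameA = 2 * h - N / t.
Proof.
have [_ _ pt _] := frameAE; have [h1 z1] := differentials_frameA.
by rewrite /dr_D1 /numer1 pt h1 z1 dot0r -/h -/N -/t; field.
Qed.

Lemma dr_D2_frameA :
  dr_D2 S V0 Z0 t0 x frameA frameA = 2 * t - 4 * h + 2 * (N / t).
Proof.
have [pV _ pt _] := frameAE; have [h1 z1] := differentials_frameA.
rewrite /dr_D2 /numer2 /numer1 /height2 pt pV h1 z1 !dot0l !dot0r.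
by rewrite -/t -/h -/N; field.
Qed.

(** With [D = N / t] the three blocks contribute [dot W W * D],
    [4 * dot zeta zeta] and [(2 * h - D)^2]; as
    [4 * (h^2 + dot zeta zeta) = 4 * t * D], the sum is
    [D * (dot W W + 4 * t - 4 * h + D)], and [dot W W / 4 = h - t - t0]. *)
Lemma sum_D1_sqr :
  \sum_a dr_D1 S V0 Z0 t0 x (row a (dr_dL S x)) ^+ 2
  = (N / t) ^+ 2 - 4 * t0 * (N / t).
Proof.
rewrite (sum_dr_frame (fun u => dr_D1 S V0 Z0 t0 x u ^+ 2)).
rewrite dr_D1_frameA.
under eq_bigr do rewrite dr_D1_frameV exprMn expr_div_n s_sqr.
under [X in _ + X + _]eq_bigr do rewrite dr_D1_frameZ exprMn.
rewrite -!mulr_sumr.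
have -> : \sum_(i < n) (h *: W + Jop S zeta W) ord0 i ^+ 2 =
    dot (h *: W + Jop S zeta W) (h *: W + Jop S zeta W).
  by apply: eq_bigr => i _; rewrite expr2.
have -> : \sum_(i < m) zeta ord0 i ^+ 2 = dot zeta zeta.
  by apply: eq_bigr => i _; rewrite expr2.
rewrite dot_scale_add_Jop.
have -> : N = h ^+ 2 + dot zeta zeta by [].
have -> : h = t + t0 + 4^-1 * dot W W by [].
by field; exact: t_neq0.
Qed.

(** The brackets of [W] with the basis contribute [m] times as much as the
    squares of the coordinates of [W], whence the factor [m + 1]. *)
Lemma sum_D2 :
  \sum_a dr_D2 S V0 Z0 t0 x (row a (dr_dL S x)) (row a (dr_dL S x))
  = 2^-1 * (m%:R + 1) * dot W W + n%:R * h + 2 * m%:R * t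
    + (2 * t - 4 * h + 2 * (N / t)).
Proof.
rewrite (sum_dr_frame (fun u => dr_D2 S V0 Z0 t0 x u u)) dr_D2_frameA.
under eq_bigr do rewrite dr_D2_frameV.
under [X in _ + X + _]eq_bigr do rewrite dr_D2_frameZ.
rewrite 2!big_split /= -!mulr_sumr sum_dot_br !sumr_const !card_ord.
rewrite -[\sum_(i < n) _]/(dot W W) -(mulr_natl h) -(mulr_natl t).
by field.
Qed.

Lemma sum_connection_D1 :
  \sum_b dr_D1 S V0 Z0 t0 x (row b (dr_dL S x)) *
    \sum_a (dr_gram1 S x (row a (dr_dL S x)) (row a (dr_dL S x))
              (row b (dr_dL S x))
      - 2^-1 * dr_gram1 S x (row b (dr_dL S x)) (row a (dr_dL S x))
              (row a (dr_dL S x)))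
  = (n%:R / 2 + m%:R - 1) * (2 * h - N / t).
Proof.
under eq_bigr do rewrite sum_connection.
rewrite (sum_dr_frame (fun u => dr_D1 S V0 Z0 t0 x u *
  ((n%:R / 2 + m%:R - 1) * (ptt u / t)))).
have [_ _ -> _] := frameAE; rewrite dr_D1_frameA divff // mulr1.
rewrite !big1 ?add0r => [|j _|i _]; first exact: mulrC.
  by have [_ _ -> _] := frameZE j; rewrite mul0r !mulr0.
by have [_ _ -> _] := frameVE i; rewrite mul0r !mulr0.
Qed.

End FrameEvaluation.

(** * The isoparametric property *)

Lemma C2_on_quadratic (R : realType) (X : set R) (a b : R) :
  C2_on X (fun y => a * (y * y) + b * y).
Proof.
pose q y : R := a * (y * y) + b * y; pose q1 y : R := a * (y + y) + b.
have did y := is_derive_id y (1 : R).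
have dc (c y : R) := is_derive_const c y (1 : R).
have dq y : is_derive y (1 : R) q (q1 y).
  have := is_derive_add (is_derive_mul (dc a y)
    (is_derive_mul (did y) (did y))) (is_derive_mul (dc b y) (did y)).
  by move/is_derive_eq; apply; rewrite /q1; ring.
have dq1 y : is_derive y (1 : R) q1 (a * 2).
  have := is_derive_add (is_derive_mul (dc a y)
    (is_derive_add (did y) (did y))) (dc b y).
  by move/is_derive_eq; apply; ring.
have qE : derive1 q = q1.
  by apply/funext => y; rewrite derive1E; have [_ ->] := dq y.
have q1E : derive1 q1 = fun=> a * 2.
  by apply/funext => y; rewrite derive1E; have [_ ->] := dq1 y.
exists setT; split=> [|//|y _]; first exact: openT.
split; first by have [] := dq y.
  by rewrite qE; have [] := dq1 y.
by rewrite /derive1n /= qE q1E; exact: cst_continuous.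
Qed.

Theorem theorem6p1 (R : realType) (n m : nat) (S : damek_ricci R n m)
    (V0 : 'rV[R]_n) (Z0 : 'rV[R]_m) (t0 : R) :
  isoparametric (@half_space R n m) (dr_metric S) (dr_D S V0 Z0 t0).
Proof.
split; first exact: smooth_D.
exists (fun y => (1 + n%:R / 2 + m%:R) * y - 2 * (1 + m%:R) * t0).
exists (fun y => 1 * (y * y) + - (4 * t0) * y); split.
- apply: continuous_subspaceT => y; apply: cvgB; last exact: cvg_cst.
  by apply: cvgM; [exact: cvg_cst|exact: cvg_id].
- exact: C2_on_quadratic.
- move=> x x_pos; have t_neq0 : ptt x != 0 by rewrite gt_eqF.
  rewrite (laplace_beltrami_frame (unitmx_dr_dL S x_pos) (erefl _)
    (dr_D1_scalar S V0 Z0 t0 x) (fun i => partial_D S V0 Z0 t0 i x_pos)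
    (dr_D2_biscalar S V0 Z0 t0 x)
    (fun i j => partial_partial_D S V0 Z0 t0 i j x_pos)
    (dr_gram1_lin1 S x) (dr_gram1_lin S x) (partial_dr_metric S x_pos)).
  rewrite sum_D2 // sum_connection_D1 // dr_DE /height.
  by field; exact: t_neq0.
- move=> x x_pos.
  rewrite (riem_sqnorm_frame (unitmx_dr_dL S x_pos) (erefl _)
    (dr_D1_scalar S V0 Z0 t0 x) (fun i => partial_D S V0 Z0 t0 i x_pos)).
  by rewrite sum_D1_sqr // dr_DE [_^-1 * _]mulrC; ring.
Qed.
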